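(* Let $m\ge 2$, $n\ge 1$ and let $\mathcal{A}=(a_{i_1\cdots i_m})\in T_{m,n}$ be nonnegative, i.e. $a_{i_1\cdots i_m}\ge 0$ for all $i_1,\ldots,i_m\in I_n$. Then $\mathcal{A}$ is a Q-tensor if and only if $a_{ii\cdots i}>0$ for all $i\in I_n$.
   Context: $T_{m,n}$ is the set of real $m$th order $n$-dimensional tensors $\mathcal{A}=(a_{i_1\cdots i_m})$, with real entries indexed by $i_1,\ldots,i_m\in I_n:=\{1,\ldots,n\}$ (no symmetry assumed). For $\mathbf{x}\in\mathbb{R}^n$, $\mathcal{A}\mathbf{x}^{m-1}\in\mathbb{R}^n$ is the vector with components $(\mathcal{A}\mathbf{x}^{m-1})_i=\sum_{i_2,\ldots,i_m=1}^n a_{ii_2\cdots i_m}x_{i_2}\cdots x_{i_m}$. Vector inequalities are componentwise. Tensor complementarity problem $(\mathbf{q},\mathcal{A})$, for $\mathbf{q}\in\mathbb{R}^n$: find $\mathbf{x}\in\mathbb{R}^n$ such that $\mathbf{x}\ge\mathbf{0}$, $\mathbf{q}+\mathcal{A}\mathbf{x}^{m-1}\ge\mathbf{0}$ and $\mathbf{x}^\top(\mathbf{q}+\mathcal{A}\mathbf{x}^{m-1})=0$. $\mathcal{A}$ is a Q-tensor iff $(\mathbf{q},\mathcal{A})$ has a solution for every $\mathbf{q}\in\mathbb{R}^n$. *)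

(* Defs.v *)
From mathcomp Require Import all_boot all_order all_algebra.
From mathcomp Require Import reals.

Set Implicit Arguments.
Unset Strict Implicit.
Unset Printing Implicit Defensive.

Import Order.TTheory GRing.Theory Num.Theory.
Local Open Scope ring_scope.

Definition tensor (R : Type) (m n : nat) := {ffun m.-tuple 'I_n -> R}.

Definition nonneg_tensor (R : realType) (m n : nat) (A : tensor R m n) : Prop :=
  forall j : m.-tuple 'I_n, 0 <= A j.

(* The vector A x^(m-1): the sum runs over the multi-indices
   j = (i_1, ..., i_m) with i_1 = i, and the product over i_2, ..., i_m.
   Selecting j by its head avoids casting an (m-1)-tuple preceded by i to an
   m-tuple. *)
Definition tensor_app (R : realType) (m n : nat) (A : tensor R m n)
    (x : 'cV[R]_n) : 'cV[R]_n :=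
  \col_i \sum_(j : m.-tuple 'I_n | ohead j == Some i)
            A j * \prod_(k <- behead j) x k 0.

Definition nonneg_vec (R : realType) (n : nat) (v : 'cV[R]_n) : Prop :=
  forall i : 'I_n, 0 <= v i 0.

Definition TCP_solution (R : realType) (m n : nat) (q : 'cV[R]_n)
    (A : tensor R m n) (x : 'cV[R]_n) : Prop :=
  [/\ nonneg_vec x,
      nonneg_vec (q + tensor_app A x)
    & x^T *m (q + tensor_app A x) = 0].

Definition Q_tensor (R : realType) (m n : nat) (A : tensor R m n) : Prop :=
  forall q : 'cV[R]_n, exists x : 'cV[R]_n, TCP_solution q A x.

(* Main.v *)
Require Import Defs.
From mathcomp Require Import all_boot all_order all_algebra.
From mathcomp Require Import reals.

(* If a_{i...i} = 0, then for q with q_i = -1 and all other entries 1, a solution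
   x is supported on i, so (A x^(m-1))_i = 0 and the i-th inequality fails.

   Conversely, let x^+ be the positive part of x. A zero x of the map with
   components q_i + (A (x^+)^(m-1))_i + min(x_i, 0) gives the solution x^+. Such
   a zero exists by the Poincare-Miranda theorem on a large box: positivity of
   the diagonal makes the i-th component nonnegative on the face where x_i is
   maximal, and the term min(x_i, 0) makes it nonpositive on the opposite face.

   Poincare-Miranda follows, by compactness, from a cubical Sperner lemma. For
   0/1-valued functions l_1, ..., l_n on a grid, with l_i = 0 and l_i = 1 on the
   two faces orthogonal to direction i, the cochain dl_1 dl_2 ... dl_n over F_2
   (cubical cup product) is the coboundary of l_1 dl_2 ... dl_n, so Stokes and
   induction on the dimension show that its integral over the grid is 1. Hence
   it is nonzero on some unit cube, on which no l_i is constant. *)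

Set Implicit Arguments.
Unset Strict Implicit.
Unset Printing Implicit Defensive.
Import Order.TTheory GRing.Theory Num.Theory.
Local Open Scope ring_scope.

(** * A cubical Sperner lemma *)

Lemma F2_addrr (a : 'F_2) : a + a = 0.
Proof. exact/addrr_pchar2/pchar_Fp. Qed.

Lemma F2_opp (a : 'F_2) : - a = a.
Proof. exact/oppr_pchar2/pchar_Fp. Qed.

Section OffDiagonalSums.
Variable n : nat.
Implicit Types (S : {set 'I_n}) (i j : 'I_n).

Lemma setD1C S i j : S :\ i :\ j = S :\ j :\ i.
Proof. by apply/setP => k; rewrite !inE andbCA. Qed.

(** The terms for [(i, j)] and [(j, i)] agree and cancel in characteristic 2. *)
Lemma sum_sym_F2 S (F : 'I_n -> 'I_n -> 'F_2) :
  (forall i j, F i j = F j i) -> \sum_(i in S) \sum_(j in S :\ i) F i j = 0.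
Proof.
move=> symF.
rewrite (eq_bigr (fun i => \sum_(j in S | (i < j)%N) F i j +
    \sum_(j in S | (j < i)%N) F i j)); last first.
  move=> i _; rewrite (bigID (fun j => (i < j)%N)) /=; congr (_ + _).
    apply: eq_bigl => j; rewrite !inE -val_eqE /=.
    by case: ltngtP; rewrite ?andbT ?andbF.
  apply: eq_bigl => j; rewrite !inE -val_eqE /=.
  by case: ltngtP; rewrite ?andbT ?andbF.
rewrite big_split /= [X in _ + X](exchange_big_dep (mem S)) //=; last first.
  by move=> i j _ /andP[].
rewrite -big_split /= big1 // => i Si.
rewrite [X in _ + X](eq_bigl (fun j => (j \in S) && (i < j)%N)); last first.
  by move=> j; rewrite Si.
by rewrite (eq_bigr _ (fun j _ => symF i j)) F2_addrr.
Qed.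

Lemma sum_setD1C S (F : 'I_n -> 'I_n -> 'F_2) :
  \sum_(i in S) \sum_(j in S :\ i) F i j = \sum_(i in S) \sum_(j in S :\ i) F j i.
Proof.
rewrite (exchange_big_dep (mem S)) /=; last by move=> i j _; case/setD1P.
apply: eq_bigr => i Si; apply: eq_bigl => j.
by rewrite !inE Si andbT eq_sym andbC.
Qed.

End OffDiagonalSums.

Section CupProduct.
Variables (n N : nat).
Local Notation grid := {ffun 'I_n -> 'I_N.+1}.
Implicit Types (x y z : grid) (S : {set 'I_n}) (i j k : 'I_n) (s : seq 'I_n).

Definition set_coord i c x : grid := [ffun k => if k == i then c else x k].
Definition shift i x : grid := set_coord i (inord (x i).+1) x.

Lemma shift_neq i j x : j != i -> shift i x j = x j.
Proof. by rewrite ffunE => /negPf ->. Qed.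

Lemma shiftC i j x : shift i (shift j x) = shift j (shift i x).
Proof.
have [->//|ij] := eqVneq i j.
apply/ffunP => k; rewrite !ffunE.
rewrite [j == i]eq_sym (negPf ij).
by case: (eqVneq k i) => [->|//]; rewrite (negPf ij).
Qed.

Variable l : 'I_n -> grid -> 'F_2.

(* [cup s x S] is the value of the cup product of the coboundaries of the [l k],
   [k] in [s], on the unit cube with lowest vertex [x] spanned by the directions
   in [S]. Its expansion is a sum over the monotone edge paths of this cube. At
   the upper boundary of the grid [shift] takes junk values. *)
Fixpoint cup s x S : 'F_2 :=
  if s is k :: s' then
    \sum_(i in S) (l k (shift i x) - l k x) * cup s' (shift i x) (S :\ i)
  else (S == set0)%:R.

(* A product of coboundaries is a cocycle. *)
Lemma cup_closed s x S :
  \sum_(i in S) cup s (shift i x) (S :\ i) = \sum_(i in S) cup s x (S :\ i).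
Proof.
elim: s x S => [//|k s IH] x S /=.
(* Both sides reduce to this sum by the induction hypothesis; the remaining terms are symmetric in
   [i] and [j] and cancel. *)
transitivity (\sum_(i in S) \sum_(j in S :\ i)
   l k (shift i x) * cup s (shift i x) (S :\ i :\ j)).
  under eq_bigr => i _ do under eq_bigr => j _ do rewrite mulrBl.
  under eq_bigr => i _ do rewrite sumrB.
  rewrite sumrB sum_sym_F2 ?sub0r ?F2_opp; last first.
    by move=> i j; rewrite shiftC setD1C.
  by apply: eq_bigr => i _; rewrite -!mulr_sumr IH.
apply/esym.
under eq_bigr => i _ do under eq_bigr => j _ do rewrite mulrBl.
under eq_bigr => i _ do rewrite sumrB -[X in _ - X]mulr_sumr IH mulr_sumr.
rewrite sumrB [X in _ - X]sum_sym_F2 ?subr0; last by move=> i j; rewrite setD1C.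
by rewrite sum_setD1C; apply: eq_bigr => i _; apply: eq_bigr => j _; rewrite setD1C.
Qed.

(** Leibniz rule: by [cup_closed], moving [cup s] from [shift i x] to [x] in the terms with factor
    [l k x] preserves their sum. Each summand becomes a difference along direction [i]. *)
Lemma cup_cons_exact k s x S :
  cup (k :: s) x S =
  \sum_(i in S) (l k (shift i x) * cup s (shift i x) (S :\ i) -
                 l k x * cup s x (S :\ i)).
Proof.
rewrite sumrB -mulr_sumr -cup_closed mulr_sumr -sumrB.
by apply: eq_bigr => i _; rewrite mulrBl.
Qed.

(** Paths in directions from [S] keep coordinate [i] fixed, so [l k] has zero increment on each
    edge. *)
Lemma cup_eq0 s x S i k : k \in s -> i \notin S ->
  (forall y, y i = x i -> l k y = l k x) -> cup s x S = 0.
Proof.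
move=> + + lk; elim: s x S lk => // k' s IH x S lk; rewrite inE => ks iS /=.
apply: big1 => j jS.
have ij : i != j by apply: contraNneq iS => ->.
case/orP: ks => [/eqP <-|ks]; first by rewrite lk ?subrr ?mul0r ?shift_neq.
rewrite (IH (shift j x)) ?mulr0 // ?inE ?negb_and ?iS ?orbT //.
by move=> y; rewrite shift_neq // => yx; rewrite !lk ?shift_neq.
Qed.

Definition in_cube x S y :=
  forall j, y j = x j \/ (j \in S) /\ y j = inord (x j).+1.

(** Some path contributes a nonzero product, so [l k] changes along one of its edges, with ends [y]
    and [z]. *)
Lemma cup_neq0 s x S k : k \in s -> cup s x S != 0 ->
  exists y z, [/\ in_cube x S y, in_cube x S z & l k y != l k z].
Proof.
elim: s x S => // k' s IH x S; rewrite inE => ks /= nz.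
have [i iS] : exists2 i, i \in S &
    (l k' (shift i x) - l k' x) * cup s (shift i x) (S :\ i) != 0.
  apply/exists_inP; apply: contraNT nz; rewrite negb_exists_in.
  by move=> /forall_inP nz; apply/eqP/big1 => i /nz; rewrite negbK => /eqP.
rewrite mulf_eq0 negb_or subr_eq0 => /andP[lk nz'].
have xS y : in_cube (shift i x) (S :\ i) y -> in_cube x S y.
  move=> yi j; have := yi j; rewrite ffunE !inE.
  by case: eqVneq => [->|_ //]; move=> [->|[]//]; right.
case/orP: ks => [/eqP ->|/IH{}IH].
  exists (shift i x), x; split=> //; first by apply: xS => j; left.
  by move=> j; left.
by have [y [z [/xS ? /xS ? ?]]] := IH _ _ nz'; exists y, z.
Qed.

(* Lowest vertices of the unit cubes in directions [S] lying on the face of the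
   grid where the coordinates outside [S] are maximal. *)
Definition box S : pred grid :=
  fun x => [forall j, (x j != ord_max) == (j \in S)].

(** The sum is grouped by lines in direction [i], each represented by its end point with
    [x i = ord_max], and telescopes along each line. *)
Lemma sum_box_telescope S i (Q : grid -> 'F_2) : i \in S ->
  \sum_(x | box S x) (Q (shift i x) - Q x) =
  \sum_(x | box (S :\ i) x) (Q x - Q (set_coord i ord0 x)).
Proof.
move=> iS.
have boxP x : box S x = (x i != ord_max) && box (S :\ i) (set_coord i ord_max x).
  apply/forallP/andP => [bx|[xi /forallP bx] j].
    split; first by rewrite (eqP (bx i)).
    apply/forallP => j; rewrite ffunE !inE.
    by case: (eqVneq j i) => [_|_]; [rewrite eqxx|exact: bx].
  have := bx j; rewrite ffunE !inE; case: (eqVneq j i) => [->|//].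
  by rewrite iS xi.
rewrite (partition_big (set_coord i ord_max) (box (S :\ i))) /=; last first.
  by move=> x; rewrite boxP => /andP[].
apply: eq_bigr => y yS.
have yi : y i = ord_max.
  by move: (forallP yS i); rewrite !inE eqxx eqbF_neg negbK => /eqP.
have sy c : set_coord i ord_max (set_coord i c y) = y.
  by apply/ffunP => j; rewrite !ffunE; case: eqVneq => // ->.
rewrite (reindex_onto (fun c => set_coord i c y) (fun x => x i)) /=; last first.
  move=> x /andP[_ /eqP <-]; apply/ffunP => j; rewrite !ffunE.
  by case: eqVneq => // ->.
rewrite (eq_bigl (fun c => c != ord_max)); last first.
  by move=> c; rewrite boxP sy yS !eqxx !ffunE !eqxx !andbT.
pose g c := Q (set_coord i (inord c) y).
have -> : Q y = g N.
  by congr Q; apply/ffunP => j; rewrite ffunE; case: eqVneq => // ->; rewrite yi;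
     apply: val_inj; rewrite /= inordK.
have -> : Q (set_coord i ord0 y) = g 0%N.
  by congr (Q (set_coord _ _ _)); apply: val_inj; rewrite /= inordK.
(* The excluded index [ord_max] is split off; for [c < N] the shift is a true successor. *)
rewrite -(telescope_sumr g) // big_mkord big_mkcond big_ord_recr /= eqxx addr0.
apply: eq_bigr => c _; rewrite -val_eqE /= ltn_eqF //=; congr (_ - _).
  congr Q; apply/ffunP => j; rewrite !ffunE; case: eqVneq => // _.
  by rewrite eqxx.
by congr (Q (set_coord _ _ _)); apply: val_inj; rewrite /= inordK // ltnS ltnW.
Qed.

Hypothesis l0 : forall i x, x i = ord0 -> l i x = 0.
Hypothesis l1 : forall i x, x i = ord_max -> l i x = 1.

(* Stokes: the summand is exact, and only the face [x k = N] contributes,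
   [k] being the head of [s]; there it is the same sum in one dimension less. *)
Lemma sum_cup s : uniq s ->
  \sum_(x | box [set i in s] x) cup s x [set i in s] = 1.
Proof.
elim: s => [_|k s IH]; last rewrite cons_uniq => /andP[ks us].
  rewrite (big_pred1 [ffun=> ord_max]) /= => [|x].
    by rewrite set_nil eqxx.
  apply/forallP/eqP => [bx|-> j]; last by rewrite ffunE eqxx !inE.
  by apply/ffunP => j; move: (bx j); rewrite ffunE !inE eqbF_neg negbK => /eqP.
under eq_bigr => x _ do rewrite cup_cons_exact.
rewrite exchange_big /=.
under eq_bigr => i iS do rewrite sum_box_telescope //.
have kS : k \in [set i in k :: s] by rewrite !inE eqxx.
have sS : [set i in s] = [set i in k :: s] :\ k.
  apply/setP => i; rewrite !inE.
  by case: (eqVneq i k) => [->|//]; rewrite (negPf ks).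
rewrite sS in IH.
rewrite (bigD1 k) //= [X in _ + X]big1 ?addr0.
  rewrite -(IH us); apply: eq_bigr => x /forallP/(_ k).
  rewrite !inE eqxx eqbF_neg negbK => /eqP xk.
  by rewrite l1 // mul1r l0 ?mul0r ?subr0 // ffunE eqxx.
(* For [i] in [s], [l i] is constantly 1 on the upper face and constantly 0 on the lower one, so
   both [cup] terms vanish. *)
move=> i /andP[]; rewrite !inE => /predU1P[->|si ik]; first by rewrite eqxx.
apply: big1 => x /forallP/(_ i); rewrite !inE eqxx eqbF_neg negbK => /eqP xi.
rewrite (@cup_eq0 _ _ _ i i) ?mulr0 ?inE ?eqxx //; last first.
  by move=> y; rewrite xi => yi; rewrite !l1.
rewrite (@cup_eq0 _ _ _ i i) ?mulr0 ?subrr ?inE ?eqxx //.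
by move=> y; rewrite ffunE eqxx => yi; rewrite !l0 // ffunE eqxx.
Qed.

End CupProduct.

Lemma cubical_sperner n N (l : 'I_n -> pred {ffun 'I_n -> 'I_N.+1}) :
    (forall i (x : {ffun 'I_n -> 'I_N.+1}), x i = ord0 -> ~~ l i x) ->
    (forall i (x : {ffun 'I_n -> 'I_N.+1}), x i = ord_max -> l i x) ->
  exists x : {ffun 'I_n -> 'I_N.+1}, forall i, exists y z : {ffun 'I_n -> 'I_N.+1},
    [/\ l i y, ~~ l i z, forall j, (x j <= y j <= (x j).+1)%N &
        forall j, (x j <= z j <= (x j).+1)%N].
Proof.
move=> l0 l1; pose L i x : 'F_2 := (l i x)%:R.
have : \sum_(x | box [set i in enum 'I_n] x)
         cup L (enum 'I_n) x [set i in enum 'I_n] != 0.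
  rewrite sum_cup ?enum_uniq ?oner_eq0 //.
    by move=> i x /l0; rewrite /L => /negPf ->.
  by move=> i x /l1; rewrite /L => ->.
case: (pickP (fun x => box [set i in enum 'I_n] x &&
         (cup L (enum 'I_n) x [set i in enum 'I_n] != 0))); last first.
  move=> nz; rewrite big1 ?eqxx // => x bx; move: (nz x).
  by rewrite bx /=; case: eqP.
move=> x /andP[/forallP bx nz] _; exists x => i.
(* No coordinate is maximal, so [inord] never takes its default value here. *)
have xN j : (x j < N)%N.
  move: (bx j); rewrite inE mem_enum -val_eqE /= eqb_id neq_ltn.
  by case/orP=> //; rewrite ltnNge -ltnS ltn_ord.
have cubeP y : in_cube x [set i in enum 'I_n] y ->
    forall j, (x j <= y j <= (x j).+1)%N.
  move=> xy j; have [->|[_ ->]] := xy j; first by rewrite leqnn leqnSn.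
  by rewrite inordK ?leqnn ?leqnSn // ltnS.
have [|y [z [/cubeP xy /cubeP xz]]] := @cup_neq0 _ _ L _ _ _ i _ nz.
  by rewrite mem_enum.
rewrite /L; case ly: (l i y); case lz: (l i z); rewrite ?eqxx // => _.
  by exists y, z; rewrite lz.
by exists z, y; rewrite ly.
Qed.

(** * The Poincare-Miranda theorem *)

From mathcomp Require Import all_classical topology normedtype.
Import numFieldNormedType.Exports.

Theorem poincare_miranda (R : realType) n (a b : R) (G : 'I_n -> 'rV[R]_n -> R) :
    a <= b -> (forall i, continuous (G i)) ->
    (forall i (x : 'rV[R]_n), (forall j, a <= x 0 j <= b) ->
      x 0 i = a -> G i x <= 0) ->
    (forall i (x : 'rV[R]_n), (forall j, a <= x 0 j <= b) ->
      x 0 i = b -> 0 <= G i x) ->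
  exists x : 'rV[R]_n, (forall j, a <= x 0 j <= b) /\ forall i, G i x = 0.
Proof.
move=> ab cG Ga Gb; pose d := b - a.
have d0 : 0 <= d by rewrite subr_ge0.
pose close N (x y : 'rV[R]_n) := forall j, `|x 0 j - y 0 j| <= d / N.+1%:R.
have approx N : exists x : 'rV[R]_n, (forall j, a <= x 0 j <= b) /\
    forall i, (exists2 y, close N x y & G i y <= 0) /\
              (exists2 y, close N x y & 0 <= G i y).
  pose pt (p : {ffun 'I_n -> 'I_N.+2}) : 'rV[R]_n :=
    \row_j (a + d * ((p j)%:R / N.+1%:R)).
  have N0 : 0 < N.+1%:R :> R by rewrite ltr0n.
  have ptab p j : a <= pt p 0 j <= b.
    rewrite mxE lerDl mulr_ge0 ?divr_ge0 ?ler0n //=.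
    rewrite -lerBrDl ler_piMr // ler_pdivrMr // mul1r ler_nat.
    by rewrite -ltnS ltn_ord.
  have pt0 (p : {ffun 'I_n -> 'I_N.+2}) j : p j = ord0 -> pt p 0 j = a.
    by move=> pj; rewrite mxE pj mul0r mulr0 addr0.
  have pt1 (p : {ffun 'I_n -> 'I_N.+2}) j : p j = ord_max -> pt p 0 j = b.
    by move=> pj; rewrite mxE pj divff ?gt_eqF // mulr1 /d addrC subrK.
  (* The second disjunct labels the upper face correctly even where [G i] vanishes; the weak
     inequality [0 <= G i] survives there. *)
  have [||p near_p] := @cubical_sperner n N.+1
      (fun i p => (0 < G i (pt p)) || (p i == ord_max)).
  - by move=> i p pi; rewrite negb_or -leNgt Ga ?pt0 // pi.
  - by move=> i p ->; rewrite eqxx orbT.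
  have closeP (q : {ffun 'I_n -> 'I_N.+2}) :
      (forall j, (p j <= q j <= (p j).+1)%N) -> close N (pt p) (pt q).
    move=> pq j; rewrite !mxE opprD addrACA subrr add0r -mulrBr -mulrBl.
    rewrite normrM (ger0_norm d0).
    rewrite ler_wpM2l // normrM (ger0_norm (x := _^-1)) ?invr_ge0 ?ler0n //.
    rewrite ler_piMl ?invr_ge0 ?ler0n // distrC.
    have /andP[pq1 pq2] := pq j.
    by rewrite -natrB // normr_nat (ler_nat _ _ 1) leq_subLR addn1.
  exists (pt p); split=> // i.
  have [y [z [ly lz /closeP py /closeP pz]]] := near_p i.
  split; [exists (pt z) => //|exists (pt y) => //].
    by move: lz; rewrite negb_or -leNgt => /andP[].
  by case/orP: ly => [/ltW //|/eqP yi]; apply: Gb; rewrite ?pt1.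
have [X XP] := choice approx.
have [z [zab clz]] : ([set v : 'rV[R]_n | forall j, `[a, b] (v ord0 j)]
    `&` cluster (X @ \oo) !=set0)%classic.
  apply: (rV_compact (A := fun=> `[a, b]%classic)).
    by move=> j; exact: segment_compact.
  by exists 0%N => // N _ j /=; rewrite in_itv /=; exact: (XP N).1.
exists z; split; first by move=> j; have := zab j; rewrite /= in_itv.
(* If [g z > 0], then [g > 0] on a ball of radius [r] at [z]. Some [X N] lies within [r / 2] of [z]
   with mesh below [r / 2], so its neighbour [y] is in that ball. *)
have lim_le0 (g : 'rV[R]_n -> R) : continuous g ->
    (forall N, exists2 y, close N (X N) y & g y <= 0) -> g z <= 0.
  move=> cg gX; rewrite leNgt; apply/negP => gz.
  have /nbhs_ballP[r /= r0 gr] : nbhs z [set y | 0 < g y]%classic.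
    exact: cvgr_gt (cg z) _ gz.
  have small : \forall N \near \oo%classic, d / N.+1%:R < r / 2.
    near=> N; rewrite ltr_pdivrMr ?ltr0n // mulrC -ltr_pdivrMr ?divr_gt0 //.
    rewrite (@lt_le_trans _ _ N%:R) ?ler_nat //.
    by near: N; exact: nbhs_infty_gtr.
  have [_ [[N [dN <-]] zN]] :
    ((X @` [set N | d / N.+1%:R < r / 2]) `&` ball z (r / 2) !=set0)%classic.
    apply: clz; last by apply: nbhsx_ballx; rewrite divr_gt0.
    by apply: filterS small => N dN; exists N.
  have [y Xy] := gX N; rewrite leNgt => /negP; apply.
  apply: (gr y); apply: (ball_split zN); split; first by rewrite divr_gt0.
  move=> i j; rewrite ord1; apply: le_lt_trans dN; exact: Xy.
move=> i; apply/eqP; rewrite eq_le; apply/andP; split.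
  by apply: lim_le0 => // N; have [] := (XP N).2 i.
rewrite -oppr_le0; apply: (lim_le0 (fun y => - G i y)).
  by move=> y; exact: cvgN (cG i y).
by move=> N; have [_ [y ? ?]] := (XP N).2 i; exists y; rewrite // oppr_le0.
Unshelve. all: by end_near.
Qed.

(** * Complementarity *)

Section TensorBounds.
Variables (R : realType) (m n : nat) (A : tensor R m n).
Hypothesis A_ge0 : nonneg_tensor A.
Implicit Types (x : 'cV[R]_n) (i k : 'I_n).

Lemma val_diag_tuple (T : Type) (c : T) : [tuple c | _ < m] = nseq m c :> seq T.
Proof. by rewrite /= -[in RHS](size_enum_ord m); elim: (enum _) => //= _ s ->. Qed.

Lemma eq_diag_tuple (j : m.-tuple 'I_n) i :
  ohead j == Some i -> all (pred1 i) (behead j) -> j = [tuple i | _ < m].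
Proof.
move=> hj bj; apply: val_inj; apply: etrans (esym (val_diag_tuple _)).
transitivity (nseq (size j) i); last by rewrite size_tuple.
apply/all_pred1P; move: hj bj; rewrite /=.
by case: (tval j) => //= ? ? /eqP[->] ->; rewrite eqxx.
Qed.

Lemma tensor_app_ge0 x i : nonneg_vec x -> 0 <= tensor_app A x i 0.
Proof.
move=> x0; rewrite mxE sumr_ge0 // => j _.
by rewrite mulr_ge0 ?A_ge0 // prodr_ge0 // => k _; exact: x0.
Qed.

Lemma tensor_app_ge_diag x i : (0 < m)%N -> nonneg_vec x ->
  A [tuple i | _ < m] * x i 0 ^+ m.-1 <= tensor_app A x i 0.
Proof.
move=> m0 x0; rewrite mxE (bigD1 [tuple i | _ < m]); last first.
  by rewrite val_diag_tuple; case: m m0.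
rewrite val_diag_tuple.
have -> : behead (nseq m i) = nseq m.-1 i by case: m.
rewrite big_nseq iter_mulr_1.
rewrite lerDl sumr_ge0 // => j _.
by rewrite mulr_ge0 ?A_ge0 // prodr_ge0 // => k _; exact: x0.
Qed.

(** Summing over all multi-indices makes the bound independent of [i]. *)
Lemma tensor_app_le x i b : nonneg_vec x -> (forall k, x k 0 <= b) ->
  tensor_app A x i 0 <= \sum_(j : m.-tuple 'I_n) A j * b ^+ m.-1.
Proof.
move=> x0 xb; rewrite mxE big_mkcond ler_sum // => j _.
have b0 : 0 <= b by apply: le_trans (x0 i) (xb i).
case: ifP => _; last by rewrite mulr_ge0 ?A_ge0 ?exprn_ge0.
rewrite ler_wpM2l ?A_ge0 //.
apply: le_trans (_ : \prod_(k <- behead j) b <= _).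
  by apply: ler_prod => k _; rewrite x0 xb.
by rewrite big_const_seq iter_mulr_1 count_predT size_behead size_tuple.
Qed.

(** Any off-diagonal multi-index with head [i] contains some [k != i], where [x] vanishes. *)
Lemma tensor_app_diag0 x i : A [tuple i | _ < m] = 0 ->
  (forall k, k != i -> x k 0 = 0) -> tensor_app A x i 0 = 0.
Proof.
move=> Ai x0; rewrite mxE big1 // => j hj.
have [bj|] := boolP (all (pred1 i) (behead j)).
  by rewrite (eq_diag_tuple hj bj) Ai mul0r.
rewrite -has_predC => /hasP[k kj ki].
by rewrite (big_rem k) //= x0 ?mul0r ?mulr0.
Qed.

End TensorBounds.

Lemma continuous_tensor_app_pos (R : realType) m n (A : tensor R m n) i :
  continuous (fun x : 'rV[R]_n => tensor_app A (\col_k Num.max (x 0 k) 0) i 0).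
Proof.
rewrite [X in continuous X](_ : _ = fun x : 'rV[R]_n =>
    \sum_(j : m.-tuple 'I_n | ohead j == Some i)
       A j * \prod_(k <- behead j) Num.max (x 0 k) 0); last first.
  apply/funext => x; rewrite mxE; apply: eq_bigr => j _.
  by congr (_ * _); apply: eq_bigr => k _; rewrite mxE.
have cmax k : continuous (fun x : 'rV[R]_n => Num.max (x 0 k) 0).
  move=> x; apply: (@continuous_max _ _ (fun y : 'rV[R]_n => y 0 k) (fun=> 0)).
    exact: coord_continuous.
  exact: cst_continuous.
have cprod s : continuous (fun x : 'rV[R]_n => \prod_(k <- s) Num.max (x 0 k) 0).
  by apply: continuous_big => // z; exact: mul_continuous.
apply: continuous_big => [z|j _ x]; first exact: add_continuous.
apply: (@continuousM _ _ (fun=> A j)); last exact: cprod.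
exact: cst_continuous.
Qed.

Theorem theorem3p5 (R : realType) (m n : nat) (hm : (2 <= m)%N) (hn : (1 <= n)%N)
    (A : tensor R m n) (hA : nonneg_tensor A) :
  Q_tensor A <-> (forall i : 'I_n, 0 < A [tuple i | _ < m]).
Proof.
split=> [QA i|A_gt0 q].
  rewrite lt_neqAle hA andbT eq_sym; apply/eqP => Ai.
  have [x [x0 w0]] := QA (\col_k (if k == i then -1 else 1)).
  (* A zero sum of nonnegative products: each vanishes, and for [k != i] the slack is at least 1,
     forcing [x k 0 = 0]. *)
  move=> /matrixP/(_ 0 0); rewrite !mxE => /eqP; rewrite psumr_eq0.
    move=> /allP xw.
    have := w0 i; rewrite mxE (tensor_app_diag0 Ai) => [|k ki].
      by rewrite mxE eqxx addr0 oppr_ge0 ler10.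
    have := xw k (mem_index_enum _); rewrite mxE mulf_eq0 => /orP[/eqP //|].
    by rewrite mxE mxE (negPf ki) gt_eqF // ltr_wpDr ?tensor_app_ge0.
  by move=> k _; rewrite mxE mulr_ge0.
have m0 : (0 < m)%N by exact: ltn_trans hm.
(* With diagonal entry [a], [b] gives [a * b >= |q i 0|]; the summand 1 ensures [b <= b ^+ m.-1]. *)
pose b := 1 + \sum_i `|q i 0| / A [tuple i | _ < m].
(* [K] bounds [q] plus the tensor term on the box, so [min(x_i, 0) = - K] outweighs them on the
   lower face. *)
pose K := \sum_i `|q i 0| + \sum_(j : m.-tuple 'I_n) A j * b ^+ m.-1.
have b1 : 1 <= b.
  by rewrite lerDl sumr_ge0 // => i _; rewrite divr_ge0 // ltW.
have b0 : 0 <= b by exact: le_trans b1.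
have K0 : 0 <= K.
  by rewrite addr_ge0 ?sumr_ge0 // => j _; rewrite mulr_ge0 ?hA ?exprn_ge0.
pose pos (x : 'rV[R]_n) : 'cV[R]_n := \col_k Num.max (x 0 k) 0.
have pos0 x : nonneg_vec (pos x) by move=> k; rewrite mxE le_max lexx orbT.
pose G i (x : 'rV[R]_n) := q i 0 + tensor_app A (pos x) i 0 + Num.min (x 0 i) 0.
have [||i x xKb xi|i x xKb xi|x [_ Gx]] := @poincare_miranda R n (- K) b G.
- by rewrite (@le_trans _ _ 0) ?oppr_le0.
- move=> i x; apply: (@continuousD _ _ _
    (fun y => q i 0 + tensor_app A (pos y) i 0) (fun y => Num.min (y 0 i) 0)).
    apply: (@continuousD _ _ _ (fun=> q i 0)); first exact: cst_continuous.
    exact: continuous_tensor_app_pos.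
  apply: (@continuous_min _ _ (fun y : 'rV[R]_n => y 0 i) (fun=> 0)).
    exact: coord_continuous.
  exact: cst_continuous.
- rewrite /G xi min_l ?oppr_le0 // subr_le0 lerD //.
    rewrite (le_trans (ler_norm _)) // (bigD1 i) //= lerDl.
    exact: sumr_ge0.
  apply: tensor_app_le => // k; rewrite mxE ge_max b0 andbT.
  by case/andP: (xKb k).
- rewrite /G xi min_r // addr0.
  rewrite -lerBlDl sub0r; apply: le_trans (tensor_app_ge_diag hA i m0 (pos0 x)).
  rewrite mxE xi max_l //.
  rewrite (@le_trans _ _ (A [tuple i | _ < m] * b)) //; last first.
    rewrite ler_pM2l // -[leLHS]expr1 ler_weXn2l //.
    by rewrite -ltnS prednK.
  rewrite mulrC -ler_pdivrMr // (@le_trans _ _ (`|q i 0| / A [tuple i | _ < m])) //.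
    by rewrite ler_pM2r ?invr_gt0 // -normrN ler_norm.
  rewrite /b (bigD1 i) //= addrCA lerDl addr_ge0 // sumr_ge0 // => k _.
  by rewrite divr_ge0 // ltW.
(* At a zero of [G] the slack is the negative part of [x], complementary to [pos x]. *)
have wE i : (q + tensor_app A (pos x)) i 0 = - Num.min (x 0 i) 0.
  by rewrite mxE; apply/eqP; rewrite -addr_eq0; apply/eqP; exact: Gx.
exists (pos x); split=> //.
  by move=> i; rewrite wE oppr_ge0 ge_min lexx orbT.
apply/matrixP => r c; rewrite !ord1 !mxE big1 // => i _.
rewrite wE !mxE; case: (leP (x 0 i) 0) => _; first by rewrite mul0r.
by rewrite oppr0 mulr0.
Qed.
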